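(* If $U\subset\mathbb{T}_m$ satisfies the unique continuation property (UCP), then $\psi(U)$ is dense in $[0,1]$.
   Context: Let $m>2$ be an integer and let $\alpha,\beta>0$ with $\alpha+\beta=1$. The directed tree $\mathbb{T}_m$ consists of the empty sequence $\emptyset$ (the root) and all finite sequences $(a_1,\dots,a_k)$, $k\ge1$, with $a_i\in\{0,1,\dots,m-1\}$; its elements are called vertices. The set $\mathcal{S}(x)$ of successors of a vertex $x$ consists of the $m$ vertices obtained by appending one coordinate to $x$. For a vertex $x=(a_1,\dots,a_k)$ put $\psi(x)=\sum_{i=1}^k a_i m^{-i}\in[0,1]$ (with $\psi(\emptyset)=0$). A function $u:\mathbb{T}_m\to\mathbb{R}$ is $p$-harmonious if for all $x\in\mathbb{T}_m$, $$u(x)=\frac{\alpha}{2}\Big\{\max_{y\in\mathcal{S}(x)}u(y)+\min_{y\in\mathcal{S}(x)}u(y)\Big\}+\frac{\beta}{m}\sum_{y\in\mathcal{S}(x)}u(y).$$ A subset $U\subset\mathbb{T}_m$ satisfies UCP if every bounded $p$-harmonious function $u$ with $u=0$ on $U$ satisfies $u\equiv0$ on $\mathbb{T}_m$. *)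

(* Defs.v *)
From HB Require Import structures.
From mathcomp Require Import all_boot all_order all_algebra.
From mathcomp Require Import all_classical all_reals all_analysis.
Import Order.TTheory GRing.Theory Num.Theory.
Import numFieldNormedType.Exports.

Set Implicit Arguments.
Unset Strict Implicit.
Unset Printing Implicit Defensive.

Local Open Scope classical_set_scope.
Local Open Scope ring_scope.

(* The root is [::]; the vertex (a_1, ..., a_k) is [:: a_1; ...; a_k]. *)
Definition vertex (m : nat) : Type := seq 'I_m.

Definition succs (m : nat) (x : vertex m) : seq (vertex m) :=
  [seq rcons x a | a : 'I_m].

(* Indices are shifted: the entry a_(i+1) sits at position i. *)
Definition psi (R : realType) (m : nat) (x : vertex m) : R :=
  \sum_(i < size x) (tnth (in_tuple x) i)%:R / m%:R ^+ i.+1.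

(* Folding from the head of s makes these the maximum and the minimum of s
   whenever s is nonempty; on [::] both are 0. *)
Definition seqmax (R : realType) (s : seq R) : R :=
  \big[Num.max/head 0 s]_(r <- s) r.

Definition seqmin (R : realType) (s : seq R) : R :=
  \big[Num.min/head 0 s]_(r <- s) r.

Definition p_harmonious (R : realType) (m : nat) (alpha beta : R)
    (u : vertex m -> R) : Prop :=
  forall x : vertex m,
    u x = alpha / 2 * (seqmax [seq u y | y <- succs x]
                       + seqmin [seq u y | y <- succs x])
          + beta / m%:R * \sum_(y <- succs x) u y.

Definition UCP (R : realType) (m : nat) (alpha beta : R)
    (U : set (vertex m)) : Prop :=
  forall u : vertex m -> R,
    p_harmonious alpha beta u ->
    (exists M : R, forall x, `|u x| <= M) ->
    (forall x, U x -> u x = 0) ->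
    forall x, u x = 0.

(* Main.v *)
(** If [t] lies outside the closure of [psi U], some vertex [x0] has all its
    proper descendants mapped so close to [t] that none of them is in [U].  Give
    the value [1] to the subtree of one successor of [x0], [-1] to that of another,
    and [0] to all other vertices.  At [x0] the maximum and the minimum over the
    successors cancel, and so do the terms of the mean; at every other vertex the
    function is constant on the successors, with the vertex's own value.  So it is a
    bounded nonzero p-harmonious function that vanishes on [U]. *)
Require Import Defs.
From HB Require Import structures.
From mathcomp Require Import all_boot all_order all_algebra.
From mathcomp Require Import all_classical all_reals all_analysis.
From mathcomp Require Import ring lra.
Import Order.TTheory GRing.Theory Num.Theory.
Import numFieldNormedType.Exports.

Local Open Scope classical_set_scope.
Local Open Scope ring_scope.

Lemma head_mem (T : eqType) (z c : T) (s : seq T) : c \in s -> head z s \in s.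
Proof. by case: s => //= x s _; rewrite mem_head. Qed.

Lemma seqmax_eq (R : realType) (s : seq R) (c : R) :
  c \in s -> (forall r, r \in s -> r <= c) -> seqmax s = c.
Proof.
move=> cs sc; apply/le_anti; rewrite (le_bigmax_seq _ c xpredT id cs) // andbT.
rewrite /seqmax big_seq; apply: bigmax_le => //.
(* The fold starts from [head 0 s], so this value has to be bounded as well; it belongs to [s]
   because [c] does. *)
exact/sc/(head_mem _ 0 c).
Qed.

Lemma seqmin_eq (R : realType) (s : seq R) (c : R) :
  c \in s -> (forall r, r \in s -> c <= r) -> seqmin s = c.
Proof.
move=> cs sc; apply/le_anti; rewrite (ge_bigmin_seq _ c xpredT id cs) //=.
rewrite /seqmin big_seq; apply: le_bigmin => //.
exact/sc/(head_mem _ 0 c).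
Qed.

Lemma psi_rcons (R : realType) (m : nat) (x : vertex m) (a : 'I_m) :
  psi R (rcons x a) = psi R x + a%:R / m%:R ^+ (size x).+1.
Proof.
(* With [nth] the indices are plain naturals, so the sums for [x] and [rcons x a] can be compared;
   [a] supplies the default value. *)
have psiE y : psi R y =
    \sum_(0 <= i < size y) (nth a y i)%:R / m%:R ^+ i.+1.
  by rewrite big_mkord; apply: eq_bigr => i _; rewrite (tnth_nth a).
rewrite !psiE size_rcons big_nat_recr //= nth_rcons ltnn eqxx; congr (_ + _).
by apply: eq_big_nat => i /= ix; rewrite nth_rcons ix.
Qed.

Lemma psi_cat_ge (R : realType) (m : nat) (x s : vertex m) :
  psi R x <= psi R (x ++ s).
Proof.
elim/last_ind: s => [|s a IH]; first by rewrite cats0.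
rewrite -rcons_cat psi_rcons (le_trans IH) // lerDl.
by rewrite divr_ge0 // exprn_ge0.
Qed.

(* The term [m ^- size (x ++ s)] makes the induction on [s] go through. *)
Lemma psi_cat_le (R : realType) (m : nat) (x s : vertex m) :
  psi R (x ++ s) + m%:R ^- size (x ++ s) <= psi R x + m%:R ^- size x.
Proof.
elim/last_ind: s => [|s a IH]; first by rewrite cats0.
have m_gt0 : 0 < m%:R :> R by rewrite ltr0n (leq_trans _ (ltn_ord a)).
rewrite -rcons_cat psi_rcons size_rcons (le_trans _ IH) // -addrA lerD2l.
rewrite -{2}[_^-1]mul1r -mulrDl ler_pdivrMr ?exprn_gt0 // exprS.
rewrite mulrCA mulVf ?mulr1 ?expf_neq0 ?gt_eqF //.
by rewrite natr1 ler_nat.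
Qed.

(** Both bounds are non-strict so that [r = n.+1] still gets the digit [n], where the floor would
    leave the range; this covers [t = 1] below. *)
Lemma exists_digit (R : realType) (n : nat) (r : R) :
  0 <= r <= n.+1%:R -> exists a : 'I_n.+1, a%:R <= r <= a.+1%:R.
Proof.
elim: n => [|n IH] /andP[r0 rn]; first by exists ord0; rewrite r0.
have [rle|rgt] := leP r n.+1%:R.
  have [|a ar] := IH; first by rewrite r0.
  by exists (widen_ord (leqnSn _) a).
by exists ord_max; rewrite /= ltW.
Qed.

(** The base-[m] expansion of [t]: the next digit is read off the remainder [t - psi R x] scaled by
    [m ^+ k.+1], which the induction hypothesis places in [[0, m]]. *)
Lemma exists_vertex_near (R : realType) (m : nat) (t : R) (k : nat) :
  (0 < m)%N -> 0 <= t <= 1 ->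
  exists2 x : vertex m, size x = k & psi R x <= t <= psi R x + m%:R ^- k.
Proof.
move=> m_gt0 /andP[t0 t1]; elim: k => [|k [x xk /andP[xt tx]]].
  by exists [::]; rewrite // /psi big_ord0 t0 add0r expr0 invr1.
have mR : 0 < m%:R :> R by rewrite ltr0n.
have pR j : 0 < m%:R ^+ j :> R by rewrite exprn_gt0.
case: m => // n in m_gt0 x xk xt tx mR pR *.
have [|a /andP[ar ra]] := @exists_digit R n ((t - psi R x) * n.+1%:R ^+ k.+1).
  apply/andP; split; first by rewrite mulr_ge0 ?subr_ge0 // ltW.
  by rewrite exprS mulrCA ger_pMr // -ler_pdivlMr // mul1r lerBlDl.
exists (rcons x a); first by rewrite size_rcons xk.
rewrite psi_rcons xk -lerBrDl ler_pdivrMr // ar /=.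
by rewrite -addrA -lerBlDl -{2}[_^-1]mul1r -mulrDl ler_pdivlMr // natr1.
Qed.

Lemma prefix_rconsr (T : eqType) (s x : seq T) (a : T) :
  prefix s (rcons x a) = prefix s x || (s == rcons x a).
Proof.
elim: x s => [|b x IH] s; first by rewrite prefixs0; apply: prefixs1.
case: s => [|c s] //.
by rewrite rcons_cons !prefix_cons IH eqseq_cons andb_orr.
Qed.

Lemma sum_succs (R : realType) (m : nat) (u : vertex m -> R) (x : vertex m) :
  \sum_(y <- succs x) u y = \sum_(a < m) u (rcons x a).
Proof. by rewrite /succs big_map -big_enum. Qed.

Lemma mem_map_succs (R : realType) (m : nat) (u : vertex m -> R) (x : vertex m)
    (a : 'I_m) :
  u (rcons x a) \in [seq u y | y <- succs x].
Proof. by rewrite /succs -map_comp (map_f (u \o rcons x)) ?mem_enum. Qed.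

Lemma map_succsP (R : realType) (m : nat) (u : vertex m -> R) (x : vertex m)
    (r : R) :
  r \in [seq u y | y <- succs x] -> exists a, r = u (rcons x a).
Proof. by rewrite /succs -map_comp => /mapP[a _ ->]; exists a. Qed.

Lemma prefix_rcons_self (T : eqType) (s : seq T) (a : T) :
  prefix (rcons s a) s = false.
Proof. by apply/negP => /size_prefix; rewrite size_rcons ltnn. Qed.

Definition branching (R : realType) {m : nat} (x0 : vertex m) (a b : 'I_m)
    (x : vertex m) : R :=
  (prefix (rcons x0 a) x)%:R - (prefix (rcons x0 b) x)%:R.

(** A step from [x] to a successor enters the subtree of [rcons x0 a] or [rcons x0 b] only at its
    root, whose parent is [x0]. *)
Lemma branching_rcons (R : realType) (m : nat) (x0 : vertex m) (a b : 'I_m)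
    (x : vertex m) (c : 'I_m) :
  x != x0 -> branching R x0 a b (rcons x c) = branching R x0 a b x.
Proof.
move=> xx0; rewrite /branching !prefix_rconsr !eqseq_rcons.
by rewrite ![x0 == x]eq_sym (negbTE xx0) !orbF.
Qed.

Lemma branching_succ (R : realType) (m : nat) (x0 : vertex m) (a b c : 'I_m) :
  branching R x0 a b (rcons x0 c) = (a == c)%:R - (b == c)%:R.
Proof.
by rewrite /branching !prefix_rconsr !eqseq_rcons !eqxx !prefix_rcons_self.
Qed.

Lemma branching_root (R : realType) (m : nat) (x0 : vertex m) (a b : 'I_m) :
  branching R x0 a b x0 = 0.
Proof.
by rewrite /branching !prefix_rcons_self subrr.
Qed.

Lemma branching_p_harmonious (R : realType) (m : nat) (alpha beta : R)
    (x0 : vertex m) (a b : 'I_m) :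
  alpha + beta = 1 -> a != b ->
  p_harmonious alpha beta (branching R x0 a b).
Proof.
move=> hab ab x; rewrite sum_succs.
have m0 : m%:R != 0 :> R by rewrite pnatr_eq0 -lt0n (leq_trans _ (ltn_ord a)).
have [->|xx0] := eqVneq x x0; last first.
  have cst y : y \in [seq branching R x0 a b z | z <- succs x] ->
      y = branching R x0 a b x.
    by move=> /map_succsP[c ->]; rewrite branching_rcons.
  have mem : branching R x0 a b x \in [seq branching R x0 a b z | z <- succs x].
    by rewrite -(branching_rcons R m x0 a b x a xx0) mem_map_succs.
  rewrite (seqmax_eq _ _ _ mem) => [|r /cst ->//].
  rewrite (seqmin_eq _ _ _ mem) => [|r /cst ->//].
  under eq_bigr do rewrite branching_rcons //.
  rewrite sumr_const card_ord -[branching _ _ _ _ _ *+ m]mulr_natr.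
  (* Maximum and minimum contribute [alpha] times the common value, the mean [beta] times it. *)
  rewrite -[LHS]mul1r -[X in X * _ = _]hab; field.
  exact: m0.
have memx c := mem_map_succs R m (branching R x0 a b) x0 c.
have := memx b; have := memx a; rewrite !branching_succ !eqxx eq_sym.
rewrite (negbTE ab) subr0 sub0r => m1 m2.
have bnd y : y \in [seq branching R x0 a b z | z <- succs x0] -> -1 <= y <= 1.
  move=> /map_succsP[c ->]; rewrite branching_succ.
  by case: (a == c); case: (b == c) => /=; lra.
rewrite (seqmax_eq _ _ _ m1) => [|r /bnd/andP[]//].
rewrite (seqmin_eq _ _ _ m2) => [|r /bnd/andP[]//].
rewrite branching_root subrr mulr0 add0r.
under eq_bigr do rewrite branching_succ.
have sum1 (d : 'I_m) : \sum_(c < m) (d == c)%:R = 1 :> R.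
  rewrite (bigD1 d) //= eqxx big1 ?addr0 // => c cd.
  by rewrite eq_sym (negbTE cd).
by rewrite sumrB !sum1 subrr mulr0.
Qed.

Theorem theorem5p2 (R : realType) (m : nat) (hm : (2 < m)%N)
    (alpha beta : R) (halpha : 0 < alpha) (hbeta : 0 < beta)
    (hab : alpha + beta = 1) (U : set (vertex m)) (hU : UCP alpha beta U) :
  [set t : R | 0 <= t <= 1] `<=` closure (@psi R m @` U).
Proof.
move=> t t01 B /nbhs_ballP[e /= e0 eB]; apply: contrapT => disj.
have m0 : (0 < m)%N by apply: leq_trans hm.
(* This choice gives [e^-1 < 2 ^+ k <= m%:R ^+ k]. *)
pose k := Num.bound e^-1.
have ke : m%:R ^- k < e.
  rewrite invf_plt ?posrE ?exprn_gt0 ?ltr0n //.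
  rewrite (lt_le_trans (upper_nthrootP (leqnn _))) //.
  by rewrite lerXn2r ?nnegrE ?ler_nat // ltnW.
have [x0 x0k /andP[x0t tx0]] := exists_vertex_near R m t k m0 t01.
(* Both [t] and [psi R (x0 ++ s)] lie in an interval of length [m%:R ^- k < e] starting at
   [psi R x0]. *)
have notU s : ~ U (x0 ++ s).
  move=> Us; apply: disj; exists (psi R (x0 ++ s)); split; first by exists (x0 ++ s).
  apply: eB; rewrite /ball /= ltr_norml.
  have := psi_cat_ge R m x0 s; have := psi_cat_le R m x0 s.
  have : 0 < m%:R ^- size (x0 ++ s) :> R by rewrite invr_gt0 exprn_gt0 ?ltr0n.
  by rewrite x0k; lra.
pose a : 'I_m := Ordinal m0.
pose b : 'I_m := Ordinal (leq_trans (ltnSn 1) (ltnW hm)).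
have bdd : exists M : R, forall x, `|branching R x0 a b x| <= M.
  by exists 1 => x; rewrite /branching ler_norml; case: prefix; case: prefix => /=; lra.
have harm := branching_p_harmonious R m alpha beta x0 a b hab isT.
(* UCP forces the value 0 at a vertex where the function is 1. *)
have : branching R x0 a b (rcons x0 a) = 0.
  apply: (hU _ harm bdd) => x Ux; rewrite /branching.
  have noprefix (d : 'I_m) : prefix (rcons x0 d) x = false.
    apply/negP => /prefixP[s xE]; apply: (notU (d :: s)).
    by rewrite -cat_rcons -xE.
  by rewrite !noprefix subrr.
by rewrite branching_succ eqxx /= subr0 => /eqP; rewrite oner_eq0.
Qed.
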